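(* For any primitive set $A\subset\mathbb{Z}_{>1}$ with $2\notin A$, we have $f(A)<1.60$, where $f(A)=\sum_{a\in A}\frac{1}{a\log a}$.
   Context: A set $A\subset\mathbb{Z}_{>1}$ is primitive if no member of $A$ divides another member of $A$. *)

(* Defs.v *)
From HB Require Import structures.
From mathcomp Require Import all_boot all_order all_algebra.
From mathcomp Require Import all_classical all_reals all_analysis.
Set Implicit Arguments. Unset Strict Implicit. Unset Printing Implicit Defensive.
Import Order.TTheory GRing.Theory Num.Theory.

Local Open Scope classical_set_scope.

Definition primitive (A : set nat) : Prop :=
  (forall a, A a -> (1 < a)%N) /\
  (forall a b, A a -> A b -> (a %| b)%N -> a = b).

Definition erdos_sum (R : realType) (A : set nat) : \bar R :=
  esum A (fun a : nat => ((a%:R * ln (a%:R : R))^-1)%:E).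

(* Main.v *)
Require Import Defs.
From HB Require Import structures.
From mathcomp Require Import all_boot all_order all_algebra.
From mathcomp Require Import all_classical all_reals all_analysis.
From mathcomp Require Import finmap.
From mathcomp Require Import zify ring lra.
Import Order.TTheory GRing.Theory Num.Theory.
Local Open Scope classical_set_scope.
Local Open Scope ring_scope.

Set Implicit Arguments.
Unset Strict Implicit.
Unset Printing Implicit Defensive.

(* Let [Lambda] be the von Mangoldt function and [h n = 1 / (n ln n)]. Since
   the [Lambda q] with [q] dividing [n] sum to [ln n], a unit of mass at [n > 1]
   may be moved to [n / q] with probability [Lambda q / ln n], and all of it
   ends at [1]. If [n] carries mass [h n], then [m] receives the sum of
   [Lambda q / (m q ln (m q) ^ 2)] over [q], which is at most [h m]: by
   partial summation this follows from [sum_(n <= N) Lambda n / n <= ln N],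
   a Chebyshev-type estimate. So if mass [h a] is created at each [a] in [A],
   no point carries more than [h], and none reaches a point of [A] because [A]
   is primitive. Therefore the sum of [h] over [A] is the mass arriving at [1],
   at most the sum of [Lambda q / (q ln q ^ 2)]. If [2] is not in [A], then [2]
   only carries the mass it receives, and the bound improves to the sum of
   [Lambda q / (q ln q ^ 2)] over [q <> 2] plus the sum of
   [Lambda q / (2 q ln (2 q) ^ 2)]. The terms with [q <= 16] are evaluated and
   the others are bounded by partial summation; the total is below [1.59]. *)

(** * Elementary and numerical bounds on the logarithm *)

Section Logarithm.
Variable R : realType.
Implicit Types x y : R.

Let from1_ge0 (f df : R -> R) : f 1 = 0 ->
    (forall x, 1 <= x -> is_derive x 1 f (df x)) ->
    (forall x, 1 <= x -> 0 <= df x) ->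
  forall y, 1 <= y -> 0 <= f y.
Proof.
move=> f1 fd df0 y y1; rewrite -f1.
apply: (@ger0_derive1_le_cc _ f 1 y); rewrite ?bound_itvE//.
- move=> x; rewrite in_itv/= => /andP[/ltW x1 _].
  by have [] := fd x x1.
- move=> x; rewrite in_itv/= => /andP[/ltW x1 _].
  by have H := fd x x1; rewrite derive1E derive_val df0.
- apply: derivable_within_continuous => x; rewrite in_itv/= => /andP[x1 _].
  by have [] := fd x x1.
Qed.

(** Midpoint rule for the integral of the convex function [1/x] over [[1, y]]: the difference of the
    two sides vanishes at [1] and has derivative [(x - 1)^2 / (x (x + 1)^2)]. *)
Lemma ln_ge_midpoint y : 1 <= y -> 2 - 4 / (y + 1) <= ln y.
Proof.
move=> y1; rewrite -subr_ge0.
pose f y : R := ln y - (2 - 4 * (y + 1)^-1).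
apply: (@from1_ge0 f (fun x => x^-1 - 4 * (x + 1)^-2)) y y1 => [|x x1|x x1].
- by rewrite /f ln1 -[1 + 1]/(2%:R); lra.
- have x0 : 0 < x by lra.
  have x10 : x + 1 != 0 by lra.
  have lnd := is_derive1_ln x0.
  have d1 : is_derive x 1 (fun t : R => t + 1) 1.
    by apply: is_derive_eq; rewrite addr0.
  have invd := @is_deriveV R (fun t : R => t + 1) x 1 1 x10 d1.
  have := is_deriveB lnd (is_deriveB (is_derive_cst (2 : R) x 1)
    (is_deriveZ (4 : R) invd)).
  by move/is_derive_eq; apply; rewrite /GRing.scale/=; field;
    rewrite x10 gt_eqF.
- have x0 : 0 < x by lra.
  have -> : x^-1 - 4 * (x + 1)^-2 = (x - 1) ^+ 2 / (x * (x + 1) ^+ 2).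
    by field; apply/andP; split; lra.
  by apply: divr_ge0; rewrite ?sqr_ge0// mulr_ge0 ?sqr_ge0// ltW.
Qed.

(** Trapezoid rule for the same integral; here the difference has derivative [(1 - 1/x)^2 / 2]. *)
Lemma ln_le_trapezoid y : 1 <= y -> ln y <= (y - y^-1) / 2.
Proof.
move=> y1; rewrite -subr_ge0.
pose f y : R := (y - y^-1) / 2 - ln y.
apply: (@from1_ge0 f (fun x => (1 + x^-2) / 2 - x^-1)) y y1 => [|x x1|x x1].
- rewrite /f ln1; lra.
- have x0 : 0 < x by lra.
  have xn0 : x != 0 by lra.
  have lnd := is_derive1_ln x0.
  have invd := @is_deriveV R id x 1 1 xn0 (is_derive_id x 1).
  have := is_deriveB
    (is_deriveZ (2^-1 : R) (is_deriveB (is_derive_id x 1) invd)) lnd.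
  have -> : 2^-1 \*: (id - (fun y => (id y)^-1)) - @ln R = f.
    by apply/funext => t; rewrite /f/= mulrC.
  by move/is_derive_eq; apply; rewrite /GRing.scale/=; field.
- have x0 : x != 0 by lra.
  have -> : (1 + x^-2) / 2 - x^-1 = (1 - x^-1) ^+ 2 / 2 by field.
  by rewrite divr_ge0 ?sqr_ge0.
Qed.

Lemma ln_sub_ge x y : 0 < x -> x <= y -> 2 * (y - x) / (y + x) <= ln y - ln x.
Proof.
move=> x0 xy; have y0 : 0 < y by lra.
rewrite -ln_div ?posrE//; have : 1 <= y / x by rewrite ler_pdivlMr// mul1r.
move=> /ln_ge_midpoint; apply: le_trans; rewrite le_eqVlt; apply/orP; left.
by apply/eqP; field; apply/andP; split; lra.
Qed.

Lemma ln_sub_le x y : 0 < x -> x <= y -> ln y - ln x <= (y / x - x / y) / 2.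
Proof.
move=> x0 xy; have y0 : 0 < y by lra.
rewrite -ln_div ?posrE//; have : 1 <= y / x by rewrite ler_pdivlMr// mul1r.
by move=> /ln_le_trapezoid; rewrite invf_div.
Qed.

Lemma ln_nat_gt0 n : (1 < n)%N -> 0 < ln n%:R :> R.
Proof. by move=> n1; rewrite ln_gt0// ltr1n. Qed.

Lemma ln_nat_ge0 n : 0 <= ln n%:R :> R.
Proof. by case: n => [|n]; [rewrite ln0|rewrite ln_ge0// ler1n]. Qed.

Lemma ler_ln_nat m n : (0 < m)%N -> (m <= n)%N -> ln m%:R <= ln n%:R :> R.
Proof. by move=> m0 mn; rewrite ler_ln ?posrE ?ltr0n ?ler_nat//; lia. Qed.

Lemma lnM_nat m n : (0 < m)%N -> (0 < n)%N ->
  ln (m * n)%:R = ln m%:R + ln n%:R :> R.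
Proof. by move=> m0 n0; rewrite natrM lnM// posrE ltr0n. Qed.

Lemma lnX_nat m n : (0 < m)%N -> ln (m ^ n)%:R = ln m%:R *+ n :> R.
Proof. by move=> m0; rewrite natrX lnXn// ltr0n. Qed.

Lemma ln_succ_sub_ge k : (0 < k)%N -> (k.+1%:R)^-1 <= ln k.+1%:R - ln k%:R :> R.
Proof.
move=> k0; have k0' : 0 < k%:R :> R by rewrite ltr0n.
have kS : k.+1%:R = k%:R + 1 :> R by rewrite -natr1.
have kle : k%:R <= k.+1%:R :> R by rewrite ler_nat.
apply: le_trans (ln_sub_ge k0' kle).
rewrite kS ler_pdivlMr ?ler_pdivrMl; [|lra..]; nra.
Qed.

(* The induction step is [(N + 1/2) * ln (1 + 1/N) >= 1]. *)
Lemma ln_fact_le N : (0 < N)%N ->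
  ln (N`!)%:R <= N%:R * ln N%:R - N%:R + ln N%:R / 2 + 1 :> R.
Proof.
elim: N => // -[_ _|N IH _]; first by rewrite ln1; lra.
rewrite factS lnM_nat ?fact_gt0//; have {IH} := IH isT.
set a := N.+1%:R; have a0 : 0 < a :> R by rewrite ltr0n.
have -> : N.+2%:R = a + 1 :> R by rewrite -natr1.
have a1 : a <= a + 1 by lra.
have := ln_sub_ge a0 a1; rewrite addrAC addrN add0r mulr1.
rewrite ler_pdivrMr; last by lra.
nra.
Qed.

(** The hypotheses are free of division, so that [lra] checks them on numerals. *)
Let ln_ratio_bounds a b x y : 0 < x -> x <= y ->
  a * (y + x) <= 2 * (y - x) -> y ^+ 2 - x ^+ 2 <= b * (2 * x * y) ->
  a <= ln y - ln x <= b.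
Proof.
move=> x0 xy ae be; have y0 := lt_le_trans x0 xy; apply/andP; split.
  by apply: le_trans (ln_sub_ge x0 xy); rewrite ler_pdivlMr//; lra.
apply: (le_trans (ln_sub_le x0 xy)); rewrite -subr_ge0.
have -> : b - (y / x - x / y) / 2 =
    (b * (2 * x * y) - (y ^+ 2 - x ^+ 2)) / (2 * x * y).
  by field; apply/andP; split; lra.
by rewrite divr_ge0 ?subr_ge0// !mulr_ge0// ltW.
Qed.

(* [16/15], [25/24] and [81/80] generate the same group as [2], [3] and [5]. *)
Lemma ln235_bounds :
  [/\ 692 / 1000 <= ln (2 : R) <= 694 / 1000,
      1098 / 1000 <= ln (3 : R) <= 1100 / 1000 &
      1609 / 1000 <= ln (5 : R) <= 1611 / 1000].
Proof.
have : 2 / 31 <= ln (16 : R) - ln 15 <= 31 / 480.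
  by apply: ln_ratio_bounds; lra.
have : 2 / 49 <= ln (25 : R) - ln 24 <= 49 / 1200.
  by apply: ln_ratio_bounds; lra.
have : 2 / 161 <= ln (81 : R) - ln 80 <= 1 / 80.
  by apply: ln_ratio_bounds; lra.
rewrite (@lnX_nat 2 4)// (@lnM_nat 3 5)// (@lnX_nat 5 2)// (@lnM_nat 8 3)//.
rewrite (@lnX_nat 2 3)// (@lnX_nat 3 4)// (@lnM_nat 16 5)// (@lnX_nat 2 4)//.
move: (ln 2) (ln 3) (ln 5) => l2 l3 l5 /andP[? ?] /andP[? ?] /andP[? ?].
by split; apply/andP; split; lra.
Qed.

(** Each further prime needs one ratio close to [1] in which it occurs squared: [50/49] here, then
    [121/120] for [11] and [169/168] for [13]. *)
Lemma ln7_bounds : 1944 / 1000 <= ln (7 : R) <= 1948 / 1000.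
Proof.
have : 2 / 99 <= ln (50 : R) - ln 49 <= 1 / 49.
  by apply: ln_ratio_bounds; lra.
rewrite (@lnM_nat 2 25)// (@lnX_nat 5 2)// (@lnX_nat 7 2)//.
have [+ _] := ln235_bounds.
move: (ln 2) (ln 5) (ln 7) => l2 l5 l7 /andP[? ?] /andP[? ?] /andP[? ?].
by apply/andP; split; lra.
Qed.

Lemma ln11_bounds : 2395 / 1000 <= ln (11 : R) <= 2401 / 1000.
Proof.
have : 1 / 121 <= ln (121 : R) - ln 120 <= 1 / 120.
  by apply: ln_ratio_bounds; lra.
rewrite (@lnX_nat 11 2)// (@lnM_nat 8 15)// (@lnM_nat 3 5)// (@lnX_nat 2 3)//.
have [] := ln235_bounds.
move: (ln 2) (ln 3) (ln 5) (ln 11) => l2 l3 l5 l11.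
move=> /andP[? ?] /andP[? ?] /andP[? ?] /andP[? ?].
by apply/andP; split; lra.
Qed.

Lemma ln13_bounds : 2561 / 1000 <= ln (13 : R) <= 2569 / 1000.
Proof.
have : 1 / 169 <= ln (169 : R) - ln 168 <= 1 / 168.
  by apply: ln_ratio_bounds; lra.
rewrite (@lnX_nat 13 2)// (@lnM_nat 8 21)// (@lnM_nat 3 7)// (@lnX_nat 2 3)//.
have [+ + _] := ln235_bounds; have := ln7_bounds.
move: (ln 2) (ln 3) (ln 7) (ln 13) => l2 l3 l7 l13.
move=> /andP[? ?] /andP[? ?] /andP[? ?] /andP[? ?].
by apply/andP; split; lra.
Qed.

End Logarithm.

(** * The von Mangoldt function and Chebyshev's bound *)

Section VonMangoldt.
Variable R : realType.

(** [primes n] lists the distinct prime divisors, so it is a singleton exactly when [n] is a prime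
    power [p ^ k] with [k > 0]; at numerals it computes. *)
Definition Lambda (n : nat) : R := if primes n is [:: p] then ln p%:R else 0.

Lemma Lambda_ge0 n : 0 <= Lambda n.
Proof.
by rewrite /Lambda; case: (primes n) => [|p []]//; exact: ln_nat_ge0.
Qed.

Lemma Lambda1 : Lambda 1 = 0. Proof. by []. Qed.

Lemma ln_nat_prod (I : Type) (r : seq I) (P : pred I) (F : I -> nat) :
  (forall i, P i -> (0 < F i)%N) ->
  ln (\prod_(i <- r | P i) F i)%:R = \sum_(i <- r | P i) ln (F i)%:R :> R.
Proof.
move=> F0; elim: r => [|i r IH]; first by rewrite !big_nil ln1.
rewrite !big_cons; case: ifPn => // Pi.
by rewrite lnM_nat ?F0 ?IH// prodn_cond_gt0.
Qed.

Lemma count_prime_power_dvd p n N : prime p -> (0 < n)%N -> (n <= N)%N ->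
  \sum_(1 <= d < N.+1 | (d %| n)%N && (primes d == [:: p])) (ln p%:R : R)
  = ln p%:R *+ logn p n.
Proof.
move=> pp n0 nN; rewrite -big_filter big_const_seq count_predT iter_addr_0.
(* The terms are equal, so only their number matters: the indices are the [p ^ k] with
   [1 <= k <= logn p n]. *)
congr (_ *+ _); rewrite -[RHS](size_iota 1) -[RHS](size_map (expn p)).
apply/perm_size/uniq_perm => [||d].
- by rewrite filter_uniq// iota_uniq.
- rewrite map_inj_in_uniq ?iota_uniq// => i j _ _; exact/expnI/prime_gt1.
rewrite mem_filter mem_index_iota; apply/idP/mapP => [|[k]].
  move=> /andP[/andP[dn /eqP pd] /andP[d0 dN]].
  exists (logn p d).
    rewrite mem_iota logn_gt0 pd mem_seq1 eqxx/= add1n ltnS.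
    exact: dvdn_leq_log.
  rewrite [LHS]prod_prime_decomp// prime_decompE pd/= big_seq1/=.
  by [].
rewrite mem_iota add1n ltnS => /andP[k0 kn] ->.
rewrite primesX// primes_prime// eqxx andbT.
have pkn : (p ^ k %| n)%N by rewrite pfactor_dvdn.
by rewrite pkn expn_gt0 prime_gt0//= ltnS (leq_trans _ nN)// dvdn_leq.
Qed.

(** After splitting by primes and exchanging the sums, each [p] contributes [logn p n] times [ln p]:
    the logarithm of the prime factorization. *)
Lemma sum_Lambda_dvd n N : (0 < n)%N -> (n <= N)%N ->
  \sum_(1 <= d < N.+1 | (d %| n)%N) Lambda d = ln n%:R.
Proof.
move=> n0 nN.
have -> : \sum_(1 <= d < N.+1 | (d %| n)%N) Lambda d =
    \sum_(1 <= d < N.+1 | (d %| n)%N)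
      \sum_(0 <= p < N.+1 | prime p && (primes d == [:: p])) (ln p%:R : R).
  rewrite big_nat_cond [RHS]big_nat_cond.
  apply: eq_bigr => d /andP[/andP[d0 dN] dn].
  rewrite /Lambda; case Ed : (primes d) => [|p [|q s]]; last 2 first.
  - have /andP[pp pd] : prime p && (p %| d)%N.
      have : p \in primes d by rewrite Ed mem_seq1.
      by rewrite mem_primes => /and3P[-> _ ->].
    rewrite big_mkcond/=.
    have pN : (p < N.+1)%N by rewrite (leq_trans _ dN)// ltnS dvdn_leq.
    have pin : p \in index_iota 0 N.+1 by rewrite mem_index_iota.
    rewrite (bigD1_seq p pin) ?iota_uniq//=.
    rewrite pp eqxx/=. rewrite big1 ?addr0// => q /negPf qp.
    by rewrite eqseq_cons eq_sym qp/= andbF.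
  - by rewrite big1// => i; rewrite eqseq_cons !andbF.
  - by rewrite big1// => i; rewrite andbF.
rewrite (exchange_big_dep prime)/=; last by move=> d p _ /andP[].
transitivity (\sum_(0 <= p < N.+1 | prime p) (ln p%:R *+ logn p n : R)).
  apply: eq_bigr => p pp; rewrite -(count_prime_power_dvd pp n0 nN).
  by apply: eq_bigl => d; rewrite pp.
rewrite -[in RHS](partnT n0) (widen_partn _ nN) ln_nat_prod; last first.
  move=> p _; case: p => [|p]; last by rewrite expn_gt0.
  by rewrite /logn.
rewrite [RHS]big_mkcond [LHS]big_mkcond/=; apply: eq_bigr => p _.
case: ifPn => pp; first by rewrite lnX_nat// prime_gt0.
by rewrite /logn (negPf pp)/= ln1.
Qed.

Definition chebyshev_psi (N : nat) : R := \sum_(1 <= d < N.+1) Lambda d.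
Local Notation psi := chebyshev_psi.

Lemma psiE n N : (n <= N)%N ->
  psi n = \sum_(1 <= d < N.+1 | (d <= n)%N) Lambda d.
Proof.
by move=> nN; rewrite /psi (big_nat_widen _ _ N.+1).
Qed.

(** Legendre's formula: [d] divides [n %/ d] of the factors. The terms with [d > n] vanish; the free
    upper limit [N] lets different factorials be compared term by term. *)
Lemma ln_fact_sum n N : (n <= N)%N ->
  ln (n`!)%:R = \sum_(1 <= d < N.+1) Lambda d * (n %/ d)%:R.
Proof.
move=> nN; rewrite fact_prod big_nat_cond ln_nat_prod; last first.
  by move=> i /andP[/andP[]].
rewrite -big_nat_cond.
under eq_big_nat => i /andP[i0 iN].
  rewrite -(@sum_Lambda_dvd i N) ?(leq_trans _ nN)//.
  over.
rewrite /= (exchange_big_dep predT)//=; apply: eq_bigr => d _.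
rewrite divn_count_dvd natr_sum mulr_sumr big_mkcond/=.
by apply: eq_bigr => i _; case: (d %| i)%N; rewrite ?mulr1 ?mulr0.
Qed.

(** By Legendre, [Lambda d] has coefficient [(a + b) %/ d - a %/ d - b %/ d], which is never
    negative and is at least [1] for [b < d <= a + b], as then also [a < d]. *)
Lemma psi_sub_le_ln_bin a b : (a <= b)%N ->
  psi (a + b) - psi b <= ln ('C(a + b, a))%:R.
Proof.
move=> ab.
have -> : ln ('C(a + b, a))%:R =
    ln ((a + b)`!)%:R - ln (a`!)%:R - ln (b`!)%:R :> R.
  have /= := bin_fact (leq_addr b a); rewrite addKn => <-.
  rewrite !lnM_nat ?muln_gt0 ?fact_gt0 ?bin_gt0 ?leq_addr//; ring.
rewrite (@ln_fact_sum _ (a + b))// (@ln_fact_sum a (a + b)) ?leq_addr//.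
rewrite (@ln_fact_sum b (a + b)) ?leq_addl//.
rewrite (@psiE b (a + b)) ?leq_addl// [X in _ - X]big_mkcond/= /psi -!sumrB.
apply: ler_sum_nat => d /andP[d0 dab].
rewrite -!mulrBr -[X in X - _]mulr1.
have -> : (if (d <= b)%N then Lambda d else 0) = Lambda d * (d <= b)%:R.
  by case: ifP; rewrite ?mulr1 ?mulr0.
rewrite -mulrBr ler_wpM2l ?Lambda_ge0//.
suff : (a %/ d + b %/ d + 1 <= (a + b) %/ d + (d <= b))%N.
  by rewrite -(ler_nat R) !natrD; lra.
case: (leqP d b) => bd; last first.
  have ad := leq_ltn_trans ab bd.
  have : (0 < (a + b) %/ d)%N by rewrite divn_gt0.
  by rewrite (divn_small ad) (divn_small bd); lia.
by rewrite divnD//; lia.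
Qed.

Lemma bin_le_exp2 n k : ('C(n.+1, k) <= 2 ^ n)%N.
Proof.
elim: n k => [|n IH] [|k]; rewrite ?bin0 ?expn_gt0//.
  by case: k => [|[|k]].
by rewrite binS expnS mul2n -addnn leq_add.
Qed.

(** Strong induction from [uphalf n] to [n], with the binomial at most [2 ^ (n - 1)]. Since
    [2 * uphalf n <= n + 1], the constant [3] reproduces itself, and [n = 2] is an equality. *)
Lemma psi_le n : (1 < n)%N -> psi n <= (2 * n - 3)%:R * ln 2.
Proof.
elim/ltn_ind: n => n IH; rewrite leq_eqVlt => /predU1P[<-|n2].
  by rewrite /psi big_ltn// big_ltn// big_geq// Lambda1 add0r addr0 mul1r.
have bn : ((uphalf n) < n)%N by lia.
have b1 : (1 < uphalf n)%N by lia.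
have ab : (n./2 <= uphalf n)%N by lia.
have /= := IH _ bn b1; have := psi_sub_le_ln_bin ab.
have -> : (n./2 + uphalf n = n)%N by lia.
have : ln ('C(n, n./2))%:R <= n.-1%:R * ln 2 :> R.
  rewrite mulr_natl -lnX_nat// ler_ln_nat ?bin_gt0//; first by lia.
  by rewrite -{1}(prednK (ltnW (ltnW n2))) bin_le_exp2.
have l2 : 0 <= ln 2 :> R by exact: (@ln_nat_ge0 R 2).
have : ((2 * uphalf n - 3) + n.-1)%:R <= (2 * n - 3)%:R :> R.
  by rewrite ler_nat; lia.
rewrite natrD => /(ler_wpM2r l2); rewrite mulrDl; lra.
Qed.
End VonMangoldt.

(** * A Mertens-type upper bound without error term *)

Section Mertens.
Variable R : realType.
Local Notation Lambda := (Lambda R).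
Local Notation psi := (chebyshev_psi R).

Definition Lambda_log_sum (N : nat) : R := \sum_(1 <= n < N.+1) Lambda n / n%:R.
Local Notation L := Lambda_log_sum.

Lemma sum_inv_consecutive M N : (0 < M)%N -> (M <= N)%N ->
  \sum_(M <= k < N) (k%:R * k.+1%:R)^-1 = M%:R^-1 - N%:R^-1 :> R.
Proof.
move=> M0 MN; have := telescope_sumr (fun k => - k%:R^-1 : R) MN.
rewrite opprK addrC => <-; apply: eq_big_nat => k /andP[Mk kN].
have k0 : k%:R != 0 :> R by rewrite pnatr_eq0; lia.
have k1 : k.+1%:R != 0 :> R by rewrite pnatr_eq0.
by rewrite -natr1 in k1 *; field; rewrite k0 k1.
Qed.

(* The fractional part of [N / d] is at most [(d - 1) / d], and at most
   [N / d - 1] if [d <= N]; both are at most [N / max(d, M) - 1]. *)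
Lemma frac_div_le N M d : M = uphalf N -> (0 < d)%N -> (d <= N)%N ->
  N%:R / d%:R - (N %/ d)%:R <= N%:R / (maxn d M)%:R - 1 :> R.
Proof.
move=> -> d0 dN; have d0' : 0 < d%:R :> R by rewrite ltr0n.
have q1 : (0 < N %/ d)%N by rewrite divn_gt0.
case: (leqP (uphalf N) d) => [Md|dM].
  by rewrite lerB// ler1n.
rewrite {1}(divn_eq N d) natrD natrM mulrDl.
rewrite mulfK ?gt_eqF// addrAC addrN add0r.
have M0 : 0 < (uphalf N)%:R :> R by rewrite ltr0n; lia.
rewrite lerBrDr -[X in _ + X](divff (lt0r_neq0 d0')) -mulrDl -natrD.
rewrite ler_pdivrMr// mulrAC ler_pdivlMr// -!natrM ler_nat.
have rd : (N %% d < d)%N by rewrite ltn_mod.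
have [NM|NM] : (N = 2 * uphalf N \/ N.+1 = 2 * uphalf N)%N by lia.
  by rewrite {3}NM; nia.
by nia.
Qed.

(** [N * L N - ln N!] weights [Lambda d] by the fractional part of [N / d]. The bound of
    [frac_div_le] on it is [N] times a telescoping sum of [1 / (k (k + 1))] over
    [max(d, M) <= k < N]; exchanging the sums produces [psi k]. *)
Lemma Lambda_log_sum_le_psi N : (0 < N)%N ->
  N%:R * L N <= ln (N`!)%:R +
    N%:R * \sum_(uphalf N <= k < N) psi k / (k%:R * k.+1%:R).
Proof.
move=> N0; set M := uphalf N.
have -> : N%:R * \sum_(M <= k < N) psi k / (k%:R * k.+1%:R) =
    \sum_(1 <= d < N.+1) Lambda d * (N%:R / (maxn d M)%:R - 1).
  under eq_big_nat => k /andP[Mk kN].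
    rewrite (@psiE R k N) ?(ltnW kN)// mulr_suml.
    over.
  rewrite (exchange_big_dep predT)//= mulr_sumr.
  apply: eq_big_nat => d /andP[d0 dN].
  have dM : (maxn d M <= N)%N by rewrite geq_max; lia.
  have d0' : (0 < maxn d M)%N by lia.
  rewrite -mulr_sumr mulrCA; congr (_ * _).
  have -> : \sum_(M <= i < N | (d <= i)%N) (i%:R * i.+1%:R)^-1 =
      \sum_(maxn d M <= i < N) (i%:R * i.+1%:R)^-1 :> R.
    rewrite [RHS](big_nat_widenl _ M) ?leq_maxr//.
    rewrite [LHS]big_nat_cond [RHS]big_nat_cond.
    apply: eq_bigl => i; rewrite geq_max.
    by case: (M <= i)%N => //=; rewrite andbT.
  rewrite sum_inv_consecutive// mulrBr divff// pnatr_eq0; lia.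
rewrite (@ln_fact_sum R N N)// -big_split/= mulr_sumr.
apply: ler_sum_nat => d /andP[d0 dN].
rewrite -mulrDr mulrCA ler_wpM2l ?Lambda_ge0// addrC -lerBlDr.
exact: frac_div_le.
Qed.

(** [psi_le] bounds the terms by [ln 2] times [2 / (k + 1) - 3 (1 / k - 1 / (k + 1))]; over the half
    range the [1 / (k + 1)] add up to about [ln 2]. *)
Lemma sum_psi_le N : (2 < N)%N ->
  N%:R * \sum_(uphalf N <= k < N) psi k / (k%:R * k.+1%:R) <=
  2 * ln 2 ^+ 2 * N%:R - 3 * ln 2.
Proof.
move=> N2; set M := uphalf N.
have bound K : (M <= K)%N ->
    \sum_(M <= k < K) psi k / (k%:R * k.+1%:R) <=
    ln 2 * (2 * (ln K%:R - ln M%:R) - 3 * (M%:R^-1 - K%:R^-1)).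
  move=> /subnKC <-; elim: (K - M)%N => [|k IH].
    by rewrite addn0 big_geq// !subrr !mulr0 subrr mulr0.
  rewrite addnS; move: (M + k)%N (leq_addr k M) IH => {K k} K MK IH.
  rewrite big_nat_recr//=.
  have K1 : (1 < K)%N by lia.
  have K0 : 0 < K%:R :> R by rewrite ltr0n; lia.
  have KS : K.+1%:R = K%:R + 1 :> R by rewrite -natr1.
  have psiK : psi K / (K%:R * K.+1%:R) <=
      ln 2 * (2 * K.+1%:R^-1 - 3 * (K%:R^-1 - K.+1%:R^-1)).
    have -> : 2 * K.+1%:R^-1 - 3 * (K%:R^-1 - K.+1%:R^-1) =
        (2 * K - 3)%:R / (K%:R * K.+1%:R) :> R.
      rewrite natrB ?natrM ?KS; last by lia.
      by field; apply/andP; split; lra.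
    rewrite mulrA ler_wpM2r ?invr_ge0 ?mulr_ge0//.
    by rewrite mulrC; exact: psi_le.
  have := ler_wpM2l (@ln_nat_ge0 R 2) (@ln_succ_sub_ge R K (ltnW K1)).
  move: psiK IH; rewrite !mulrBr.
  move: (_ / _) (\sum_(_ <= _ < _) _) K.+1%:R^-1 K%:R^-1 M%:R^-1 => *; lra.
have l2 := @ln_nat_ge0 R 2.
have N0 : 0 < N%:R :> R by rewrite ltr0n; lia.
apply: (le_trans (ler_wpM2l (ltW N0) (bound N _))); first by lia.
have M0 : (0 < M)%N by lia.
have M0' : 0 < M%:R :> R by rewrite ltr0n.
suff key : 2 * (ln N%:R - ln M%:R) - 3 * (M%:R^-1 - N%:R^-1) <=
    2 * ln 2 - 3 * N%:R^-1 :> R.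
  rewrite mulrA; apply: le_trans (ler_wpM2l (mulr_ge0 (ltW N0) l2) key) _.
  have -> : N%:R * ln 2 * (2 * ln 2 - 3 * N%:R^-1) =
      2 * ln 2 ^+ 2 * N%:R - 3 * ln 2 :> R by field; lra.
  exact: lexx.
have l2M : ln (2 * M)%:R = ln 2 + ln M%:R :> R by rewrite lnM_nat.
have [NM|NM] : (N = 2 * M \/ N.+1 = 2 * M)%N by rewrite /M; lia.
  by rewrite NM l2M natrM invfM; lra.
have := @ln_succ_sub_ge R N ltac:(lia); rewrite NM l2M.
have NR : N%:R = 2 * M%:R - 1 :> R by rewrite -natrM -NM -natr1 addrK.
(* The loss for odd [N]; this inequality is equivalent to [3 <= N]. *)
have : 6 * N%:R^-1 <= 8 * (2 * M)%:R^-1 :> R.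
  rewrite -NM ler_pdivrMr// mulrAC ler_pdivlMr ?ltr0n// -natr1.
  have : 3 <= N%:R :> R by rewrite ler_nat.
  lra.
rewrite natrM invfM; lra.
Qed.

(** Because [2 * ln 2 ^ 2 < 1], the term [- N] of Stirling's bound outweighs the [psi] sum and
    leaves room for [ln N / 2]. *)
Lemma Lambda_log_sum_le_ln N : (0 < N)%N -> L N <= ln N%:R.
Proof.
case: N => [//|[|[|N]]] _.
- by rewrite /L big_nat1 Lambda1 mul0r ln1.
- rewrite /L big_ltn// big_nat1 Lambda1 mul0r add0r ler_pdivrMr ?ltr0n//.
  by rewrite ler_peMr ?ler1n//; exact: (@ln_nat_ge0 R 2).
have : (2 < N.+3)%N by []; move: N.+3 => {}N N2.
have n0 : 0 < N%:R :> R by rewrite ltr0n; lia.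
rewrite -(ler_pM2l n0).
have := @Lambda_log_sum_le_psi N (ltnW (ltnW N2)).
have := @sum_psi_le N N2.
have := @ln_fact_le R N (ltnW (ltnW N2)).
have [/andP[l2l l2u] _ _] := ln235_bounds R.
(* Tangent of [ln] at [16]: half its slope, [1/32], is below the spare [36/1000]. *)
have lnn : ln N%:R <= 4 * ln 2 + N%:R / 16 - 1 :> R.
  have := @le_ln1Dx R (N%:R / 16 - 1) ltac:(lra).
  rewrite addrC subrK ln_div ?posrE//.
  have -> : ln 16 = 4 * ln 2 :> R by rewrite (@lnX_nat R 2 4)// mulr_natl.
  lra.
have : 2 * ln 2 ^+ 2 * N%:R <= 964 / 1000 * N%:R :> R.
  by rewrite ler_wpM2r ?(ltW n0)//; nra.
move: lnn (N%:R * ln N%:R) => lnn x; lra.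
Qed.
End Mertens.

(** * Tails by partial summation *)

Section Tail.
Variable R : realType.
Local Notation Lambda := (Lambda R).
Local Notation L := (Lambda_log_sum R).

(* Summation by parts against [L n <= ln n]; the main term telescopes since
   [(b - a) / b ^ 2 <= 1 / a - 1 / b]. *)
Lemma Lambda_tail_le m T X : (0 < T)%N -> (1 < m * T)%N -> (T <= X)%N ->
  \sum_(T.+1 <= n < X.+1) Lambda n / (n%:R * ln (m * n)%:R ^+ 2) <=
  (ln T%:R - L T) / ln (m * T.+1)%:R ^+ 2 + (ln (m * T)%:R)^-1.
Proof.
move=> T0 mT TX.
have m0 : (0 < m)%N by lia.
pose phi n : R := (ln (m * n)%:R ^+ 2)^-1.
pose E n : R := ln n%:R - L n.
have E0 n : (0 < n)%N -> 0 <= E n.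
  by move=> n0; rewrite subr_ge0 Lambda_log_sum_le_ln.
(* The induction on [X] keeps the boundary terms at [X], which are then dropped by sign. *)
suff : \sum_(T.+1 <= n < X.+1) Lambda n / (n%:R * ln (m * n)%:R ^+ 2) <=
    E T * phi T.+1 - E X * phi X.+1 +
    ((ln (m * T)%:R)^-1 - (ln (m * X)%:R)^-1).
  have : 0 <= E X * phi X.+1.
    by rewrite mulr_ge0 ?E0 ?(leq_trans T0)// invr_ge0 sqr_ge0.
  have : 0 <= (ln (m * X)%:R)^-1 :> R by rewrite invr_ge0 ln_nat_ge0.
  rewrite /phi -/(E T); move: (_ * _) (_^-1) => *; lra.
move: TX => /subnKC <-; elim: (X - T)%N => [|k IH].
  by rewrite addn0 big_geq// !subrr addr0.
rewrite addnS; move: (T + k)%N (leq_addr k T) IH => {X k} X TX IH.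
rewrite big_nat_recr//=.
have LX : Lambda X.+1 / X.+1%:R = L X.+1 - L X.
  by rewrite /L [X in X - _]big_nat_recr//= addrAC subrr add0r.
have X1 : (1 < m * X)%N by apply: (leq_trans mT); rewrite leq_mul2l TX orbT.
have a0 := @ln_nat_gt0 R _ X1.
have X2 : (1 < m * X.+1)%N by rewrite (leq_trans X1)// leq_mul2l leqnSn orbT.
have b0 := @ln_nat_gt0 R _ X2.
have ba : ln (m * X.+1)%:R - ln (m * X)%:R = ln X.+1%:R - ln X%:R :> R.
  by rewrite !lnM_nat//; [ring|lia].
have ab : ln (m * X)%:R <= ln (m * X.+1)%:R :> R.
  by rewrite ler_ln_nat// ?leq_mul2l ?leqnSn ?orbT//; lia.
have tele : (ln X.+1%:R - ln X%:R) * phi X.+1 <=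
    (ln (m * X)%:R)^-1 - (ln (m * X.+1)%:R)^-1 :> R.
  rewrite -ba /phi.
  move: (ln (m * X)%:R) (ln (m * X.+1)%:R) a0 b0 ab => a b a0 b0 ab.
  have -> : a^-1 - b^-1 = (b - a) / (a * b) by field; lra.
  rewrite ler_wpM2l ?subr_ge0// lef_pV2 ?posrE ?mulr_gt0// expr2.
  by rewrite ler_pM2r.
have phi_le : E X.+1 * phi X.+2 <= E X.+1 * phi X.+1.
  rewrite ler_wpM2l ?E0// lef_pV2 ?posrE ?exprn_gt0//; last first.
    apply: (lt_le_trans b0); rewrite ler_ln_nat// ?leq_mul2l ?leqnSn ?orbT//.
    by lia.
  rewrite lerXn2r ?nnegrE ?ln_nat_ge0// ler_ln_nat ?leq_mul2l ?leqnSn ?orbT//.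
  by lia.
rewrite [X in _ + X <= _](_ : _ = (L X.+1 - L X) * phi X.+1); last first.
  by rewrite -LX invfM mulrA.
move: tele phi_le IH; rewrite /E !mulrBl => *; lra.
Qed.

(** The case [T = 1], where the boundary term is zero. Divided by [m], it says that the weight
    [1 / (n ln n)] dominates its own inflow. *)
Lemma sum_Lambda_ln_sq_le m X : (1 < m)%N ->
  \sum_(1 <= q < X.+1) Lambda q / (q%:R * ln (m * q)%:R ^+ 2) <= (ln m%:R)^-1.
Proof.
move=> m1; case: X => [|X].
  by rewrite big_geq// invr_ge0 ln_nat_ge0.
rewrite big_ltn// Lambda1 mul0r add0r.
have := @Lambda_tail_le m 1 X.+1 isT; rewrite muln1 => /(_ m1 isT).
by rewrite ln1 /L big_nat1 Lambda1 !mul0r subrr mul0r add0r.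
Qed.
End Tail.

(** * The mass flow along divisors *)

Section Flow.
Variable R : realType.
Local Notation Lambda := (Lambda R).
Variables (A : pred nat) (X : nat).
Hypothesis A_bound : forall a, A a -> (1 < a <= X)%N.
Hypothesis A_prim : forall a b, A a -> A b -> (a %| b)%N -> a = b.

Definition erdos_weight (n : nat) : R := (n%:R * ln n%:R)^-1.
Local Notation h := erdos_weight.

(* Mass moves from [n] to [n / q] with probability [Lambda q / ln n]. *)
Definition inflow (f : nat -> R) (m : nat) : R :=
  \sum_(1 <= q < X.+1 | (m * q <= X)%N)
    f (m * q)%N * (Lambda q / ln (m * q)%:R).

(* [k] is fuel: the value is independent of [k] once [X < k + m]. *)
Fixpoint flow_iter (k m : nat) : R :=
  if k is k'.+1 then if A m then h m else inflow (flow_iter k') m else 0.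

Definition flow := flow_iter X.+1.

(** [Lambda 1 = 0] kills the one term that reads [f] at [m] itself, so the recursion for the flow
    descends from larger arguments. *)
Lemma eq_inflow f g m : (0 < m)%N -> (forall n, (m < n)%N -> f n = g n) ->
  inflow f m = inflow g m.
Proof.
move=> m0 fg; rewrite /inflow big_nat_cond [RHS]big_nat_cond.
apply: eq_bigr => q /andP[/andP[q0 _] _].
move: q0; rewrite leq_eqVlt => /predU1P[<-|q1].
  by rewrite Lambda1 mul0r !mulr0.
by rewrite fg// -[X in (X < _)%N]muln1 ltn_mul2l m0.
Qed.

Lemma flow_iter_stable k m : (0 < m)%N -> (X < k + m)%N ->
  flow_iter k.+1 m = flow_iter k m.
Proof.
elim: k m => [|k IH] m m0 Xkm.
  rewrite /=; case: ifPn => [/A_bound/andP[_ mX]|_]; first by lia.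
  rewrite /inflow big_nat_cond big1// => q /andP[/andP[q0 _] mqX].
  by have := leq_pmulr m q0; lia.
rewrite -/(flow_iter k.+1 m) [LHS]/= [RHS]/=; case: ifPn => // _.
apply: eq_inflow => // n mn; apply: IH; lia.
Qed.

Lemma flowE m : (0 < m)%N -> flow m = if A m then h m else inflow flow m.
Proof.
move=> m0; rewrite {1}/flow /=; case: ifPn => // _.
by apply: eq_inflow => // n mn; rewrite -flow_iter_stable//; lia.
Qed.

Lemma inflow_le f m : (1 < m)%N -> (forall n, (1 < n)%N -> f n <= h n) ->
  inflow f m <=
  m%:R^-1 * \sum_(1 <= q < X.+1) Lambda q / (q%:R * ln (m * q)%:R ^+ 2).
Proof.
move=> m1 fh; have m0 : 0 < m%:R :> R by rewrite ltr0n; lia.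
rewrite /inflow big_mkcond mulr_sumr; apply: ler_sum_nat => q /andP[q0 _].
case: ifPn => _; last first.
  rewrite mulr_ge0 ?invr_ge0// mulr_ge0 ?Lambda_ge0// invr_ge0.
  by rewrite mulr_ge0 ?sqr_ge0.
have mq1 : (1 < m * q)%N by have := leq_pmulr m q0; lia.
have /ler_wpM2r-/(_ (Lambda q / ln (m * q)%:R)) H := fh _ mq1.
apply: (le_trans (H _)); first by rewrite divr_ge0 ?Lambda_ge0 ?ln_nat_ge0.
rewrite /h natrM le_eqVlt; apply/orP; left; apply/eqP.
have := @ln_nat_gt0 R _ mq1; rewrite natrM => l0.
have q0' : 0 < q%:R :> R by rewrite ltr0n.
by field; rewrite !gt_eqF.
Qed.

Lemma flow_le m : (1 < m)%N -> flow m <= h m.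
Proof.
rewrite /flow; elim: X.+1 m => [|k IH] m m1.
  by rewrite invr_ge0 mulr_ge0 ?ln_nat_ge0.
rewrite /=; case: ifPn => // _; apply: (le_trans (inflow_le m1 IH)).
by rewrite /h invfM ler_wpM2l ?invr_ge0// sum_Lambda_ln_sq_le.
Qed.

(** Mass only moves from a number to its divisors. *)
Lemma flow_eq0 m : (forall a, A a -> ~~ (m %| a)%N) -> flow m = 0.
Proof.
rewrite /flow; elim: X.+1 m => [//|k IH] m Am /=; case: ifPn => [/Am|_].
  by rewrite dvdnn.
rewrite /inflow big1// => q _; rewrite IH ?mul0r// => a Aa.
by apply: contra (Am _ Aa); exact: dvdn_trans (dvdn_mulr _ (dvdnn _)).
Qed.

(** Mass reaching [a] from [a * q], [q > 1], would need [a * q] to divide some [b] in [A];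
    primitivity gives [b = a], which is too small. *)
Lemma inflow_flow_eq0 a : A a -> inflow flow a = 0.
Proof.
move=> Aa; have /andP[a1 _] := A_bound Aa.
rewrite /inflow big_nat_cond big1// => q /andP[/andP[q0 _] _].
move: q0; rewrite leq_eqVlt => /predU1P[<-|q1].
  by rewrite Lambda1 mul0r mulr0.
rewrite flow_eq0 ?mul0r// => b Ab; apply/negP => aqb.
have ab := A_prim Aa Ab (dvdn_trans (dvdn_mulr _ (dvdnn _)) aqb).
move: aqb; rewrite -ab => /dvdn_leq; nia.
Qed.

Lemma sum_multiples q (G : nat -> R) : (0 < q)%N ->
  \sum_(1 <= n < X.+1 | (q %| n)%N) G n =
  \sum_(1 <= m < X.+1 | (m * q <= X)%N) G (m * q)%N.
Proof.
move=> q0; rewrite -[LHS]big_filter -[RHS]big_filter.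
rewrite -(big_map (muln^~ q) predT G).
apply: perm_big; apply: uniq_perm => [||n].
- by rewrite filter_uniq ?iota_uniq.
- rewrite map_inj_uniq ?filter_uniq ?iota_uniq// => i j /eqP.
  by rewrite eqn_pmul2r// => /eqP.
rewrite mem_filter mem_index_iota; apply/idP/mapP => [|[m]].
  case/andP=> /dvdnP[m ->] /andP[m0 mX]; exists m => //.
  by rewrite mem_filter mem_index_iota; nia.
by rewrite mem_filter mem_index_iota => H ->; rewrite dvdn_mull//=; nia.
Qed.

(** Conservation of mass: by [sum_Lambda_dvd] the probabilities of leaving [n > 1] add up to [1],
    while [1] emits nothing. *)
Lemma sum_inflow (f : nat -> R) :
  \sum_(1 <= m < X.+1) inflow f m = \sum_(2 <= n < X.+1) f n.
Proof.
rewrite /inflow (exchange_big_dep predT)//=.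
under eq_big_nat => q /andP[q0 _].
  rewrite -(@sum_multiples q (fun n => f n * (Lambda q / ln n%:R)))//.
  over.
rewrite (exchange_big_dep predT)//=.
transitivity (\sum_(1 <= n < X.+1) (if (1 < n)%N then f n else 0)).
  apply: eq_big_nat => n /andP[n0 nX].
  rewrite -mulr_sumr -mulr_suml sum_Lambda_dvd//.
  case: ifPn => n1; first by rewrite divff ?mulr1// gt_eqF// ln_nat_gt0.
  have -> : n = 1%N by lia.
  by rewrite ln1 mul0r mulr0.
have [->|X0] := posnP X; first by rewrite !big_geq.
rewrite [LHS]big_ltn//= add0r; apply: eq_big_nat => n /andP[-> _] //.
Qed.

(** Summing [flowE] over all [m], total flow is total inflow plus the mass created on [A]. By
    conservation the inflow is the total flow without [flow 1], so the created mass is [flow 1]. *)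
Lemma sum_erdos_weight : \sum_(1 <= n < X.+1 | A n) h n = inflow flow 1.
Proof.
have [X0|X0] := posnP X; first by rewrite /inflow X0 !big_geq.
have : \sum_(1 <= m < X.+1) flow m =
    \sum_(1 <= m < X.+1) inflow flow m + \sum_(1 <= n < X.+1 | A n) h n.
  rewrite [X in _ + X]big_mkcond -big_split; apply: eq_big_nat => m /andP[m0 _].
  rewrite flowE//=; case: ifPn => [Am|_]; last by rewrite addr0.
  by rewrite inflow_flow_eq0// add0r.
rewrite sum_inflow big_ltn// addrC => /addrI <-.
by rewrite flowE//; case: ifPn => // /A_bound.
Qed.

(** All mass at [2] moves on to [1], as [Lambda 2 / ln 2 = 1]. Outside [A] that mass is an inflow,
    which [inflow_le] bounds; the other [q] use [flow_le]. *)
Lemma sum_erdos_weight_le : (1 < X)%N -> ~~ A 2 ->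
  \sum_(1 <= n < X.+1 | A n) h n <=
  \sum_(3 <= q < X.+1) Lambda q / (q%:R * ln q%:R ^+ 2) +
  2^-1 * \sum_(1 <= q < X.+1) Lambda q / (q%:R * ln (2 * q)%:R ^+ 2).
Proof.
move=> X1 A2; rewrite sum_erdos_weight /inflow.
have -> : \sum_(1 <= q < X.+1 | (1 * q <= X)%N)
      flow (1 * q)%N * (Lambda q / ln (1 * q)%:R) =
    \sum_(1 <= q < X.+1) flow q * (Lambda q / ln q%:R).
  rewrite big_mkcond/=; apply: eq_big_nat => q /andP[_ qX].
  by rewrite mul1n -ltnS qX.
rewrite big_ltn; last by lia.
rewrite Lambda1 mul0r mulr0 add0r big_ltn// addrC.
have L2 : Lambda 2 / ln 2 = 1 by rewrite divff// gt_eqF// (@ln_nat_gt0 R 2).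
rewrite L2 mulr1; apply: lerD.
  apply: ler_sum_nat => q /andP[q3 _].
  have q1 : (1 < q)%N by lia.
  have := flow_le q1 => /ler_wpM2r-/(_ (Lambda q / ln q%:R)) H.
  apply: (le_trans (H _)); first by rewrite divr_ge0 ?Lambda_ge0 ?ln_nat_ge0.
  rewrite /h le_eqVlt; apply/orP; left; apply/eqP.
  have l0 := @ln_nat_gt0 R _ q1.
  have q0 : 0 < q%:R :> R by rewrite ltr0n; lia.
  by field; rewrite !gt_eqF.
by rewrite flowE// (negPf A2) inflow_le// => n; exact: flow_le.
Qed.
End Flow.

(** * Numerical evaluation of the terms up to 16 *)

Section PrimePowerTerms.
Variable R : realType.
Local Notation Lambda := (Lambda R).

Lemma divr_sqr_le (x y u b d c : R) : b <= y -> x <= u ->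
  0 < d -> 0 < b -> 0 <= u -> u <= c * (d * b ^+ 2) -> x / (d * y ^+ 2) <= c.
Proof.
move=> bY xu d0 b0 u0 uc; have y0 := lt_le_trans b0 bY.
rewrite ler_pdivrMr ?mulr_gt0 ?exprn_gt0//; apply: (le_trans xu).
apply: (le_trans uc); rewrite ler_wpM2l//.
  have : 0 <= c * (d * b ^+ 2) by exact: le_trans uc.
  by rewrite pmulr_lge0// mulr_gt0 ?exprn_gt0.
by rewrite ler_pM2l// lerXn2r// nnegrE ltW.
Qed.

Lemma sum_Lambda_3_16 (F : nat -> R) :
  \sum_(3 <= q < 17) Lambda q / F q = Lambda 3 / F 3%N + Lambda 4 / F 4%N +
    Lambda 5 / F 5%N + Lambda 7 / F 7%N + Lambda 8 / F 8%N + Lambda 9 / F 9%N +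
    Lambda 11 / F 11%N + Lambda 13 / F 13%N + Lambda 16 / F 16%N.
Proof.
rewrite unlock /=.
have [-> -> -> -> ->] : [/\ Lambda 6 = 0, Lambda 10 = 0, Lambda 12 = 0,
  Lambda 14 = 0 & Lambda 15 = 0] by [].
by rewrite !mul0r !add0r addr0 !addrA.
Qed.

Lemma ln2_ge : 692 / 1000 <= ln (2 : R).
Proof. by have [/andP[]] := ln235_bounds R. Qed.

Lemma ln2_le : ln (2 : R) <= 694 / 1000.
Proof. by have [/andP[]] := ln235_bounds R. Qed.

Lemma ln3_ge : 1098 / 1000 <= ln (3 : R).
Proof. by have [_ /andP[]] := ln235_bounds R. Qed.

Lemma ln3_le : ln (3 : R) <= 1100 / 1000.
Proof. by have [_ /andP[]] := ln235_bounds R. Qed.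

Lemma ln5_ge : 1609 / 1000 <= ln (5 : R).
Proof. by have [_ _ /andP[]] := ln235_bounds R. Qed.

Lemma ln5_le : ln (5 : R) <= 1611 / 1000.
Proof. by have [_ _ /andP[]] := ln235_bounds R. Qed.

Lemma ln7_ge : 1944 / 1000 <= ln (7 : R).
Proof. by have /andP[] := ln7_bounds R. Qed.

Lemma ln7_le : ln (7 : R) <= 1948 / 1000.
Proof. by have /andP[] := ln7_bounds R. Qed.

Lemma ln11_ge : 2395 / 1000 <= ln (11 : R).
Proof. by have /andP[] := ln11_bounds R. Qed.

Lemma ln11_le : ln (11 : R) <= 2401 / 1000.
Proof. by have /andP[] := ln11_bounds R. Qed.

Lemma ln13_ge : 2561 / 1000 <= ln (13 : R).
Proof. by have /andP[] := ln13_bounds R. Qed.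

Lemma ln13_le : ln (13 : R) <= 2569 / 1000.
Proof. by have /andP[] := ln13_bounds R. Qed.

Lemma lnM_nat_ge (m n : nat) (a b c : R) : (0 < m)%N -> (0 < n)%N ->
  a <= ln m%:R -> b <= ln n%:R -> c <= a + b -> c <= ln (m * n)%:R.
Proof.
by move=> m0 n0 am bn cab; rewrite lnM_nat// (le_trans cab)// lerD.
Qed.

Lemma ln4_ge : 1384 / 1000 <= ln (4 : R).
Proof. by apply: (@lnM_nat_ge 2 2 _ _ _ isT isT ln2_ge ln2_ge); lra. Qed.

Lemma ln8_ge : 2076 / 1000 <= ln (8 : R).
Proof. by apply: (@lnM_nat_ge 2 4 _ _ _ isT isT ln2_ge ln4_ge); lra. Qed.

Lemma ln9_ge : 2196 / 1000 <= ln (9 : R).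
Proof. by apply: (@lnM_nat_ge 3 3 _ _ _ isT isT ln3_ge ln3_ge); lra. Qed.

Lemma ln16_ge : 2768 / 1000 <= ln (16 : R).
Proof. by apply: (@lnM_nat_ge 2 8 _ _ _ isT isT ln2_ge ln8_ge); lra. Qed.

Lemma ln6_ge : 1790 / 1000 <= ln (6 : R).
Proof. by apply: (@lnM_nat_ge 2 3 _ _ _ isT isT ln2_ge ln3_ge); lra. Qed.

Lemma ln10_ge : 2301 / 1000 <= ln (10 : R).
Proof. by apply: (@lnM_nat_ge 2 5 _ _ _ isT isT ln2_ge ln5_ge); lra. Qed.

Lemma ln14_ge : 2636 / 1000 <= ln (14 : R).
Proof. by apply: (@lnM_nat_ge 2 7 _ _ _ isT isT ln2_ge ln7_ge); lra. Qed.

Lemma ln18_ge : 2888 / 1000 <= ln (18 : R).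
Proof. by apply: (@lnM_nat_ge 2 9 _ _ _ isT isT ln2_ge ln9_ge); lra. Qed.

Lemma ln22_ge : 3087 / 1000 <= ln (22 : R).
Proof. by apply: (@lnM_nat_ge 2 11 _ _ _ isT isT ln2_ge ln11_ge); lra. Qed.

Lemma ln26_ge : 3253 / 1000 <= ln (26 : R).
Proof. by apply: (@lnM_nat_ge 2 13 _ _ _ isT isT ln2_ge ln13_ge); lra. Qed.

Lemma ln32_ge : 3460 / 1000 <= ln (32 : R).
Proof. by apply: (@lnM_nat_ge 2 16 _ _ _ isT isT ln2_ge ln16_ge); lra. Qed.

Lemma prime_power_head1 :
  \sum_(3 <= q < 17) Lambda q / (q%:R * ln q%:R ^+ 2) <= 1430 / 2000.
Proof.
rewrite (sum_Lambda_3_16 (fun q => q%:R * ln q%:R ^+ 2)).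
(* The bounds for [q = 3, 4, 5, 7, 8, 9, 11, 13, 16], each rounded up to a multiple of [1/2000]. *)
apply: (@le_trans _ _ (609 / 2000 + 182 / 2000 + 249 / 2000 + 148 / 2000 +
  41 / 2000 + 51 / 2000 + 77 / 2000 + 61 / 2000 + 12 / 2000));
  last by lra.
do 8 ?[apply: lerD].
- by apply: (divr_sqr_le ln3_ge ln3_le); lra.
- by apply: (divr_sqr_le ln4_ge ln2_le); lra.
- by apply: (divr_sqr_le ln5_ge ln5_le); lra.
- by apply: (divr_sqr_le ln7_ge ln7_le); lra.
- by apply: (divr_sqr_le ln8_ge ln2_le); lra.
- by apply: (divr_sqr_le ln9_ge ln3_le); lra.
- by apply: (divr_sqr_le ln11_ge ln11_le); lra.
- by apply: (divr_sqr_le ln13_ge ln13_le); lra.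
- by apply: (divr_sqr_le ln16_ge ln2_le); lra.
Qed.

Lemma prime_power_head2 :
  \sum_(1 <= q < 17) Lambda q / (q%:R * ln (2 * q)%:R ^+ 2) <= 1021 / 2000.
Proof.
rewrite big_ltn// big_ltn// Lambda1 mul0r add0r.
rewrite (sum_Lambda_3_16 (fun q => q%:R * ln (2 * q)%:R ^+ 2)) !addrA.
apply: (@le_trans _ _ (363 / 2000 + 229 / 2000 + 81 / 2000 + 122 / 2000 +
  81 / 2000 + 23 / 2000 + 30 / 2000 + 46 / 2000 + 38 / 2000 + 8 / 2000));
  last by lra.
do 9 ?[apply: lerD].
- by apply: (divr_sqr_le ln4_ge ln2_le); lra.
- by apply: (divr_sqr_le ln6_ge ln3_le); lra.
- by apply: (divr_sqr_le ln8_ge ln2_le); lra.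
- by apply: (divr_sqr_le ln10_ge ln5_le); lra.
- by apply: (divr_sqr_le ln14_ge ln7_le); lra.
- by apply: (divr_sqr_le ln16_ge ln2_le); lra.
- by apply: (divr_sqr_le ln18_ge ln3_le); lra.
- by apply: (divr_sqr_le ln22_ge ln11_le); lra.
- by apply: (divr_sqr_le ln26_ge ln13_le); lra.
- by apply: (divr_sqr_le ln32_ge ln2_le); lra.
Qed.

End PrimePowerTerms.

(** * Tails beyond 16 and the total for finite sets *)

Section Bound.
Variable R : realType.
Local Notation Lambda := (Lambda R).
Local Notation L := (Lambda_log_sum R).

(** The boundary term of [Lambda_tail_le] at [T = 16], shared by both tails. *)
Lemma ln16_sub_L_le : ln 16 - L 16 <= 63 / 100.
Proof.
rewrite /L big_ltn// big_ltn// (sum_Lambda_3_16 (fun q => q%:R)) Lambda1.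
rewrite (@lnX_nat R 2 4)// mul0r add0r.
have [-> -> -> -> ->] : [/\ Lambda 2 = ln 2, Lambda 3 = ln 3,
  Lambda 4 = ln 2, Lambda 5 = ln 5 & Lambda 7 = ln 7] by [].
have [-> -> -> -> ->] : [/\ Lambda 8 = ln 2, Lambda 9 = ln 3,
  Lambda 11 = ln 11, Lambda 13 = ln 13 & Lambda 16 = ln 2] by [].
have := ln2_le R; have := ln3_ge R; have := ln5_ge R.
have := ln7_ge R; have := ln11_ge R; have := ln13_ge R.
move: (ln 2) (ln 3) (ln 5) (ln 7) (ln 11) (ln 13) => *; lra.
Qed.

Lemma prime_power_tail1 X : (16 <= X)%N ->
  \sum_(17 <= q < X.+1) Lambda q / (q%:R * ln q%:R ^+ 2) <= 445 / 1000.
Proof.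
move=> X16; have := @Lambda_tail_le R 1 16 X isT isT X16.
under eq_bigr do rewrite mul1n.
rewrite !mul1n => /le_trans; apply.
have ln17_ge : 2768 / 1000 <= ln (17 : R).
  by apply: le_trans (ln16_ge R) (@ler_ln_nat R 16 17 _ _).
(* Bounds for [(63/100) / ln 17 ^ 2] and [1 / ln 16], both from [ln 16 >= 2.768]. *)
apply: (@le_trans _ _ (83 / 1000 + 362 / 1000)); last by lra.
apply: lerD.
  rewrite -[X in _ / X <= _]mul1r.
  by apply: (divr_sqr_le ln17_ge ln16_sub_L_le); lra.
rewrite -[leLHS]mul1r ler_pdivrMr; last exact: (@ln_nat_gt0 R 16).
by have := ln16_ge R; move: (ln 16) => x; lra.
Qed.

Lemma prime_power_tail2 X : (16 <= X)%N ->
  \sum_(17 <= q < X.+1) Lambda q / (q%:R * ln (2 * q)%:R ^+ 2) <= 343 / 1000.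
Proof.
move=> X16; apply: (le_trans (@Lambda_tail_le R 2 16 X isT isT X16)).
have ln34_ge : 3460 / 1000 <= ln (34 : R).
  by apply: le_trans (ln32_ge R) (@ler_ln_nat R 32 34 _ _).
apply: (@le_trans _ _ (53 / 1000 + 290 / 1000)); last by lra.
apply: lerD.
  rewrite -[X in _ / X <= _]mul1r.
  by apply: (divr_sqr_le ln34_ge ln16_sub_L_le); lra.
rewrite -[leLHS]mul1r ler_pdivrMr; last exact: (@ln_nat_gt0 R 32).
by have := ln32_ge R; move: (ln 32) => x; lra.
Qed.

Lemma finite_primitive_bound (A : pred nat) (X : nat) : (16 <= X)%N ->
  (forall a, A a -> (1 < a <= X)%N) ->
  (forall a b, A a -> A b -> (a %| b)%N -> a = b) -> ~~ A 2 ->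
  \sum_(1 <= n < X.+1 | A n) erdos_weight R n <= 159 / 100.
Proof.
move=> X16 A_bound A_prim A2.
apply: (le_trans (sum_erdos_weight_le R A_bound A_prim _ A2)); first by lia.
rewrite (big_cat_nat _ (n := 17))//=.
rewrite [X in _ + _ * X](big_cat_nat _ (n := 17))//=.
(* The total is [0.715 + 0.445 + (0.5105 + 0.343) / 2 = 1.58675]. *)
apply: (le_trans (lerD (lerD (prime_power_head1 R) (prime_power_tail1 X16))
  (ler_wpM2l _ (lerD (prime_power_head2 R) (prime_power_tail2 X16))))).
  by rewrite invr_ge0.
by clear; lra.
Qed.
End Bound.

(** * Passage from finite subsets to the whole set *)

Unset Implicit Arguments.
Set Strict Implicit.
Set Printing Implicit Defensive.

Theorem theorem4p4 (R : realType) (A : set nat) :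
  primitive A -> ~ A 2%N -> (erdos_sum R A < (16 / 10 : R)%:E)%E.
Proof.
move=> [A_gt1 A_prim] A2.
(* A supremum of finite sums need not keep a strict bound, so a uniform bound below [1.6] is passed
   to it. *)
apply: (@le_lt_trans _ _ (159 / 100 : R)%:E); last by rewrite lte_fin; lra.
apply: ge_ereal_sup => /= _ [F [finF FA] <-].
rewrite fsbig_finite//= sumEFin lee_fin.
pose s : seq nat := fset_set F; pose P (n : nat) := n \in s.
have PA n : P n -> A n.
  by change (n \in fset_set F -> A n); rewrite in_fset_set// => /set_mem/FA.
(* The cutoff must cover [F] and be at least [16], where the tail estimates begin. *)
set X := (16 + \max_(n <- s) n)%N.
have PX n : P n -> (1 < n <= X)%N.
  move=> Pn; rewrite (A_gt1 _ (PA _ Pn))/=.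
  exact: leq_trans (@leq_bigmax_seq _ s predT id n Pn isT) (leq_addl _ _).
have P2 : ~~ P 2 by apply/negP => /PA.
have P_prim a b : P a -> P b -> (a %| b)%N -> a = b.
  by move=> /PA Aa /PA Ab; exact: A_prim.
have X16 : (16 <= X)%N by rewrite leq_addr.
apply: (le_trans _ (finite_primitive_bound R X16 PX P_prim P2)).
rewrite -[leRHS]big_filter le_eqVlt; apply/orP; left; apply/eqP/perm_big.
apply: uniq_perm => [||n]; rewrite ?fset_uniq ?filter_uniq ?iota_uniq//.
rewrite mem_filter mem_index_iota -/(P n); case Pn : (P n) => //=.
by have := PX _ Pn; rewrite /=; lia.
Qed.
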